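(* Let $C$ and $D$ be a storage code and a retrieval code, respectively, for the private information retrieval scheme $\mathscr{S}$ described in the context; that is, $C$ is a linear $[n,k,d_C]$ code over $\mathbb{F}_{q^m}$ and $D$ is a linear code of length $n$ over $\mathbb{F}_{q^m}$. Let $\mathrm{Tr}(D)\subseteq\mathbb{F}_q^n$ be the trace code of $D$. Then one can define a low complexity variant $\mathrm{Tr}(\mathscr{S})$ of $\mathscr{S}$ by replacing the retrieval code $D$ with $\mathrm{Tr}(D)$. The scheme $\mathrm{Tr}(\mathscr{S})$ has rate $(d_{C\star\mathrm{Tr}(D)}-1)/n$, and it protects against $t'$-collusion, where $t'=d_{D^\perp|_{\mathbb{F}_q}}-1$ and $D^\perp|_{\mathbb{F}_q}=D^\perp\cap\mathbb{F}_q^n$ is the subfield subcode of $D^\perp$.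
   Context: Codes. For a linear code $E$, $d_E$ is its minimum Hamming distance. $D^\perp$ is the dual of $D$ in $\mathbb{F}_{q^m}^n$ with respect to the standard bilinear form. The trace code of $D\subseteq\mathbb{F}_{q^m}^n$ is $\mathrm{Tr}(D)=\{(\mathrm{Tr}(x_1),\dots,\mathrm{Tr}(x_n)) : x\in D\}\subseteq\mathbb{F}_q^n$, where $\mathrm{Tr}:\mathbb{F}_{q^m}\to\mathbb{F}_q$ is the field trace. The star product $C\star E$ is the span over $\mathbb{F}_{q^m}$ of all coordinatewise products of a codeword of $C$ and a codeword of $E$. Write $[r]=\{1,\dots,r\}$. The scheme with storage code $C$ and retrieval code $E$ (for $\mathscr{S}$, $E=D$; for $\mathrm{Tr}(\mathscr{S})$, $E=\mathrm{Tr}(D)$). Put $c=d_{C\star E}-1$, $b=\mathrm{lcm}(c,k)/k$ and $s=\mathrm{lcm}(c,k)/c$. There are $\mu$ files $x^1,\dots,x^\mu\in\mathbb{F}_{q^m}^{b\times k}$. They are stacked into a $\mu b\times k$ matrix $X$ and encoded as $Y=XG_C$, with $G_C$ a generator matrix of $C$; server $j\in[n]$ stores the $j$-th column $\boldsymbol{y}_j$ of $Y$. After perhaps a rearrangement of the servers, $J=\{1,\dots,\max\{k,c\}\}$ is the index set of servers from which symbols of the desired file are downloaded. To retrieve file $i$, the user chooses $\mu b$ codewords of $E$ uniformly at random and lets $\boldsymbol{d}_j$ be the vector, of length $\mu b$, of their $j$-th entries (ordered by file, then by row). For $a\in[b]$ put $J_1^a=\{(a-1)c/b+1,\dots,ac/b\}$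 and $J_1=\bigcup_a J_1^a=[c]$. Server $j$ receives the query $\boldsymbol{q}_j=\boldsymbol{d}_j+\boldsymbol{e}_{b(i-1)+a}$ if $j\in J_1^a$, and $\boldsymbol{q}_j=\boldsymbol{d}_j$ if $j\notin J_1$, where $\boldsymbol{e}_r$ is the $r$-th standard basis vector. It responds with $r_j=\langle\boldsymbol{q}_j,\boldsymbol{y}_j\rangle\in\mathbb{F}_{q^m}$. This is iterated, for $s$ iterations in total, where in iteration $u$ the sets $J_1^a$ are replaced by sets $J_u^a$ obtained from $J_{u-1}^a$ by adding $c/b$ to every element modulo $|J|$ (a cyclic shift within $J$). In each iteration the user multiplies the response vector $(r_1,\dots,r_n)^T$ by a parity check matrix of $C\star E$ to recover $c$ encoded symbols of file $i$ (those in row $a$ at the servers $j\in J_u^a$); after $s$ iterations the file is reconstructed from these symbols. ''Low complexity'' refers to the computation of the responses $r_j$: with a retrieval code contained in $\mathbb{F}_q^n$, the queries have entries in $\mathbb{F}_q$ rather than $\mathbb{F}_{q^m}$. The rate of a scheme is the size of the retrieved file divided by the total amount of data downloaded from the servers. A scheme protects against $t$-collusion (protects against $t$ colluding servers) if the queries received jointly by any $t$ servers reveal nothing about the index $i$ of the desired file.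
   Formalization: Reconstruction of the whole file is claimed only for server arrangements in which the k servers queried for each row form an information set of C (it fails otherwise); such an arrangement is shown to exist if c ≤ k or if max(k,c) servers have all k-subsets information sets. C is nonzero. *)

(* Defs.v *)
From HB Require Import structures.
From mathcomp Require Import all_boot all_order all_algebra all_fingroup all_field.

Set Implicit Arguments.
Unset Strict Implicit.
Unset Printing Implicit Defensive.

Import GRing.Theory.
Local Open Scope ring_scope.

(** * Codes *)

Definition hdist (K : finFieldType) (n : nat) (x y : 'rV[K]_n) : nat :=
  #|[set j | x 0 j != y 0 j]|.

(* A code with at most one codeword has no two words to compare; its minimum
   distance is then n + 1 (it corrects every erasure pattern). *)
Definition mindist (K : finFieldType) (n : nat) (A : {set 'rV[K]_n}) : nat :=
  \big[minn/n.+1]_(p : 'rV[K]_n * 'rV[K]_n |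
      [&& p.1 \in A, p.2 \in A & p.1 != p.2]) hdist p.1 p.2.

Definition dual_code (K : finFieldType) (n : nat) (D : {vspace 'rV[K]_n}) :
    {set 'rV[K]_n} :=
  [set y | [forall x in D, y *m x^T == 0]].

Definition star (K : finFieldType) (n : nat) (C : {vspace 'rV[K]_n})
    (E : {set 'rV[K]_n}) : {vspace 'rV[K]_n} :=
  <<[seq map2_mx *%R x y | x <- enum C, y <- enum E]>>%VS.

Definition generator_matrix (K : finFieldType) (n : nat)
    (C : {vspace 'rV[K]_n}) (G : 'M[K]_(\dim C, n)) : Prop :=
  row_free G /\ forall x : 'rV[K]_n, (x \in C) = (x <= G)%MS.

Definition parity_check (K : finFieldType) (n r : nat)
    (A : {vspace 'rV[K]_n}) (H : 'M[K]_(r, n)) : Prop :=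
  forall x : 'rV[K]_n, (x \in A) = (H *m x^T == 0).

Definition information_set (K : finFieldType) (n : nat)
    (C : {vspace 'rV[K]_n}) (I : {set 'I_n}) : Prop :=
  #|I| = \dim C /\
  forall x, x \in C -> (forall j, j \in I -> x 0 j = 0) -> x = 0.

(** * Trace codes and subfield subcodes *)

(* F is F_q.  [finvect_type L] is the extension field L = F_{q^m} itself,
   carrying in addition its structures of finite field and of splitting field
   over F. *)
Section Subfield.
Variables (F : finFieldType) (L : fieldExtType F) (n : nat).
Local Notation Lq := (finvect_type L).

Definition embed (y : 'rV[F]_n) : 'rV[Lq]_n := map_mx (in_alg Lq) y.

(* [galTrace] takes its values in L; since L / F is Galois they are of the form
   t%:A with t : F, so every x in D contributes exactly one word. *)
Definition trace_code (D : {vspace 'rV[Lq]_n}) : {set 'rV[F]_n} :=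
  [set y | [exists x in D, embed y == map_mx (galTrace 1%AS {:Lq}) x]].

Definition subfield_subcode (A : {set 'rV[Lq]_n}) : {set 'rV[F]_n} :=
  [set y | embed y \in A].

End Subfield.

(** * Private information retrieval schemes *)

(* mu files, each a matrix over K, and n servers.  The coins are uniform, and
   cover the randomness of all iterations. *)
Record pir_scheme (K : finFieldType) (n mu : nat) := PirScheme {
  file_rows : nat;
  file_cols : nat;
  niter : nat;
  qlen : nat;
  coins : finType;
  stored : ('I_mu -> 'M[K]_(file_rows, file_cols)) -> 'I_n -> 'cV[K]_qlen;
  query : 'I_mu -> coins -> 'I_niter -> 'I_n -> 'cV[K]_qlen
}.

Section Scheme.
Variables (K : finFieldType) (n mu : nat) (S : pir_scheme K n mu).

Definition file := 'M[K]_(file_rows S, file_cols S).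

Definition responses (x : 'I_mu -> file) (i : 'I_mu) (w : coins S) :
    'M[K]_(niter S, n) :=
  \matrix_(u, j) ((query i w u j)^T *m stored x j) 0 0.

(* Both sizes are counted in symbols of K. *)
Definition rate : rat :=
  (\dim {: 'M[K]_(file_rows S, file_cols S)})%:R
    / (\dim {: 'M[K]_(niter S, n)})%:R.

Definition pr (P : pred (coins S)) : rat := #|P|%:R / #|coins S|%:R.

(* The joint distribution of everything a set T of at most t servers receives,
   over all iterations, is the same for all indices of the desired file. *)
Definition protects_against_collusion (t : nat) : Prop :=
  forall T : {set 'I_n}, (#|T| <= t)%N ->
  forall (i i' : 'I_mu) (v : 'I_(niter S) -> 'I_n -> 'cV[K]_(qlen S)),
    pr (fun w => [forall u, forall j in T, query i w u j == v u j])
    = pr (fun w => [forall u, forall j in T, query i' w u j == v u j]).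

End Scheme.

(** * The star product scheme *)

Section StarScheme.
Variables (K : finFieldType) (n mu : nat).
Variables (C : {vspace 'rV[K]_n}) (E : {set 'rV[K]_n}).

Definition par_c : nat := (mindist [set x in star C E] - 1)%N.
Definition par_b : nat := (lcmn par_c (\dim C) %/ \dim C)%N.
Definition par_s : nat := (lcmn par_c (\dim C) %/ par_c)%N.

(* Rows a, iterations u and positions in J = {0, ..., max(k,c) - 1} are
   numbered from 0, so that this is the set J_{u+1}^{a+1} of the 1-based
   numbering, with every element decreased by 1. *)
Definition Jset (u a : nat) : seq nat :=
  iter u (map (fun p => (p + par_c %/ par_b) %% maxn (\dim C) par_c)%N)
       (iota (a * (par_c %/ par_b)) (par_c %/ par_b)).

(* The permutation pos is the rearrangement of the servers: server j gets the
   number pos j. *)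
Variables (G : 'M[K]_(\dim C, n)) (pos : {perm 'I_n}).

(* [mxvec_index i a] is the index of row a of file i in the stacked matrix. *)
Definition stack (x : 'I_mu -> 'M[K]_(par_b, \dim C)) :
    'M[K]_(mu * par_b, \dim C) :=
  \matrix_(r, l) mxvec (\matrix_(i < mu, a < par_b) x i a l) 0 r.

(* For every iteration and every row of the stacked matrix, a codeword of E. *)
Definition star_coins : finType :=
  {ffun 'I_par_s * 'I_(mu * par_b) -> {x : 'rV[K]_n | x \in E}}.

Definition star_query (i : 'I_mu) (w : star_coins) (u : 'I_par_s) (j : 'I_n) :
    'cV[K]_(mu * par_b) :=
  let d := \col_r (val (w (u, r))) 0 j in
  if [pick a : 'I_par_b | (pos j : nat) \in Jset u a] is Some a
  then d + delta_mx (mxvec_index i a) 0 else d.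

Definition star_scheme : pir_scheme K n mu :=
  @PirScheme K n mu par_b (\dim C) par_s (mu * par_b) star_coins
    (fun x j => col j (stack x *m G)) star_query.

(* The encoded symbols of file i to be downloaded in iteration u: those in row a
   at the servers of J_u^a (the other entries are set to 0). *)
Definition downloaded (x : 'I_mu -> 'M[K]_(par_b, \dim C)) (i : 'I_mu)
    (u : 'I_par_s) : 'M[K]_(par_b, n) :=
  \matrix_(a, j) if (pos j : nat) \in Jset u a then (x i *m G) a j else 0.

(* For every row, the servers from which symbols of that row are downloaded
   form an information set of C. *)
Definition admissible_arrangement : Prop :=
  forall a : 'I_par_b, information_set C
    [set j | [exists u : 'I_par_s, (pos j : nat) \in Jset u a]].

End StarScheme.

(* A sufficient condition for an admissible arrangement of the servers to
   exist; it is always satisfied when c <= k or when C is MDS. *)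
Definition arrangeable (K : finFieldType) (n : nat)
    (C : {vspace 'rV[K]_n}) (E : {set 'rV[K]_n}) : Prop :=
  (par_c C E <= \dim C)%N \/
  exists J : {set 'I_n}, #|J| = maxn (\dim C) (par_c C E) /\
    forall I : {set 'I_n}, I \subset J -> #|I| = \dim C -> information_set C I.

(* Main.v *)
Require Import Defs.
From HB Require Import structures.
From mathcomp Require Import all_boot all_order all_algebra all_fingroup all_solvable all_field.

Set Implicit Arguments.
Unset Strict Implicit.
Unset Printing Implicit Defensive.

Import GRing.Theory.
Local Open Scope ring_scope.

(* A word supported on the c servers of an iteration is determined by its
   syndrome, because c < d(C * Tr(D)); this gives the decoding and the rate.
   For privacy, Lagrange interpolation at the conjugates of a separating element
   alpha writes every z as a combination of the traces Tr(alpha^k z).  Hence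
   D lies in the span of Tr(D), so that d(C * Tr(D)) <= d(C * D), and an F-word
   orthogonal to Tr(D) is orthogonal to D (Delsarte).  Consequently Tr(D) takes
   all values on any t' coordinates, and the difference between the queries for
   two files is absorbed by a translation of the random codewords. *)

(** * Minimum distance and information sets *)

Section MinimumDistance.
Variables (K : finFieldType) (n : nat).
Implicit Types (A B : {set 'rV[K]_n}) (x y : 'rV[K]_n).

Lemma leq_mindist A m :
  (m <= n.+1)%N ->
  (forall x y, x \in A -> y \in A -> x != y -> m <= hdist x y)%N ->
  (m <= mindist A)%N.
Proof.
move=> le_m leA; rewrite /mindist.
elim/big_ind: _ => // [a b|[x y] /= /and3P[]]; last exact: leA.
by rewrite leq_min => -> ->.
Qed.

Lemma mindist_leq_hdist A x y :
  x \in A -> y \in A -> x != y -> (mindist A <= hdist x y)%N.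
Proof.
move=> Ax Ay neq_xy; rewrite /mindist.
elim: (index_enum _) (mem_index_enum (x, y)) => // p r IHr.
rewrite inE big_cons => /predU1P[<-|/IHr le_r]; first by rewrite /= Ax Ay neq_xy geq_minl.
by case: ifP => // _; apply: leq_trans (geq_minr _ _) le_r.
Qed.

Lemma mindist_leqSn A : (mindist A <= n.+1)%N.
Proof.
rewrite /mindist; elim/big_rec: _ => // p m _ le_m.
exact: leq_trans (geq_minr _ _) le_m.
Qed.

Lemma hdist_gt0 x y : x != y -> (0 < hdist x y)%N.
Proof.
move=> neq_xy; rewrite card_gt0; apply: contraNneq neq_xy => eq_xy.
apply/eqP/rowP=> j; move/setP/(_ j): eq_xy.
by rewrite !inE => /negbT; rewrite negbK => /eqP.
Qed.

Lemma mindist_gt0 A : (0 < mindist A)%N.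
Proof. by apply: leq_mindist => // x y _ _; apply: hdist_gt0. Qed.

Lemma mindist_subset A B : A \subset B -> (mindist B <= mindist A)%N.
Proof.
move=> /subsetP sAB; apply: leq_mindist => [|x y Ax Ay]; first exact: mindist_leqSn.
by apply: mindist_leq_hdist; apply: sAB.
Qed.

Lemma eq0_supported_code A x (T : {set 'I_n}) :
  0 \in A -> x \in A -> (forall j, j \notin T -> x 0 j = 0) ->
  (#|T| <= mindist A - 1)%N -> x = 0.
Proof.
move=> A0 Ax x0 leT; apply: contraTeq leT => nz_x.
(* The minimum distance is positive, so the truncated [- 1] really lowers it by one. *)
rewrite -ltnNge -subSn ?mindist_gt0 // subn1 /=.
apply: leq_trans (mindist_leq_hdist Ax A0 nz_x) (subset_leq_card _).
apply/subsetP=> j; rewrite inE mxE; apply: contraNT.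
by move=> /x0 ->.
Qed.

Lemma generator_matrixP (C : {vspace 'rV[K]_n}) :
  exists G : 'M[K]_(\dim C, n), generator_matrix G.
Proof.
pose G := \matrix_(i < \dim C) (vbasis C)`_i.
have mulG (v : 'rV_(\dim C)) : v *m G = \sum_i v 0 i *: (vbasis C)`_i.
  by rewrite mulmx_sum_row; apply: eq_bigr => i _; rewrite rowK.
have /andP[/eqP spanC /freeP freeC] := vbasisP C.
exists G; split=> [|x].
  apply: inj_row_free => v; rewrite mulG => /freeC v0.
  by apply/rowP=> i; rewrite v0 mxE.
apply/idP/submxP => [Cx|[v ->]].
  exists (\row_i coord (vbasis C) i x).
  by rewrite mulG {1}(coord_vbasis Cx); apply: eq_bigr => i _; rewrite mxE.
by rewrite mulG rpred_sum // => i _; rewrite rpredZ ?vbasis_mem ?mem_nth ?size_tuple.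
Qed.

(** A generator matrix has full row rank, so some [\dim C] of its columns form an invertible matrix;
    a codeword vanishing at these columns has zero coefficients. *)
Lemma information_set_exists (C : {vspace 'rV[K]_n}) :
  exists I : {set 'I_n}, information_set C I.
Proof.
have [G [freeG memG]] := generator_matrixP C.
have fullGt : row_full G^T by rewrite /row_full mxrank_tr.
pose f := fullrankfun fullGt.
exists [set f i | i in 'I_(\dim C)]; split.
  by rewrite card_imset ?card_ord //; apply: fullrankfun_inj.
move=> x; rewrite memG => /submxP[v ->] x0.
have unitG := fullrowsub_unit fullGt.
have : rowsub f G^T *m v^T = 0.
  apply/colP=> i; rewrite [RHS]mxE -[RHS](x0 (f i)) ?imset_f // !mxE.
  by apply: eq_bigr => l _; rewrite !mxE mulrC.
move/(congr1 (mulmx (invmx (rowsub f G^T)))); rewrite mulKmx // mulmx0.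
by move/(congr1 trmx); rewrite trmxK trmx0 => ->; rewrite mul0mx.
Qed.

(** The projection of [W] to the coordinates in [T] fails to be onto only if a nonzero linear form
    on these coordinates kills it; such a form is a word supported on [T] and orthogonal to [W]. *)
Lemma dual_supported_surj (W : {vspace 'rV[K]_n}) (T : {set 'I_n}) :
  (forall a : 'rV[K]_n, (forall j, j \notin T -> a 0 j = 0) ->
    (forall y, y \in W -> y *m a^T = 0) -> a = 0) ->
  forall f : 'I_n -> K, exists2 y, y \in W & forall j, j \in T -> y 0 j = f j.
Proof.
move=> dual0 f; have [G [_ memG]] := generator_matrixP W.
pose P : 'M[K]_n := diag_mx (\row_j (j \in T)%:R).
have mulP m (A : 'M[K]_(m, n)) i j : (A *m P) i j = A i j * (j \in T)%:R.
  by rewrite mul_mx_diag !mxE.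
have sub_fG : ((\row_j f j) *m P <= G *m P)%MS.
  rewrite submxE; set Z := cokermx _; apply/eqP/rowP=> l.
  (* A column of the cokernel of [G *m P], cut down to [T], is supported on [T] and orthogonal to
     [W], hence zero by [dual0]. *)
  pose a := P *m (Z *m delta_mx l (0 : 'I_1)).
  suff a0 : a^T = 0.
    transitivity (((\row_j f j) *m a) 0 0); last by rewrite -[a]trmxK a0 trmx0 mulmx0 !mxE.
    by rewrite /a !mulmxA -colE [RHS]mxE.
  apply: dual0 => [j /negPf Tj|y].
    by rewrite mxE /a mul_diag_mx !mxE Tj mul0r.
  rewrite memG => /submxP[v ->].
  by rewrite trmxK -mulmxA /a (mulmxA G) (mulmxA (G *m P)) mulmx_coker mul0mx mulmx0.
have /submxP[v defv] := sub_fG.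
exists (v *m G); first by rewrite memG submxMl.
move=> j Tj; have /rowP/(_ j) := defv.
by rewrite mulmxA !mulP Tj !mulr1 mxE => ->.
Qed.

End MinimumDistance.

(** * Trace codes *)

Section Trace.
Variables (F : finFieldType) (L : fieldExtType F).
Local Notation Lq := (finvect_type L).
Local Notation tr := (galTrace 1%AS {:Lq}).

(** A generator of the cyclic group of units works: an automorphism that fixes it fixes all its
    powers, hence the whole field. *)
Lemma gal_separating_element :
  exists alpha : Lq, forall g : gal_of {:Lq}, g alpha = alpha -> g = 1%g.
Proof.
have /cyclicP[a defU] := field_unit_group_cyclic [set: {unit Lq}]%G.
exists (val a) => g fix_a; apply/eqP/gal_eqP => x _; rewrite gal_id.
have [->|nz_x] := eqVneq x 0; first by rewrite rmorph0.
have: finField_unit nz_x \in <[a]>%g by rewrite -defU inE.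
case/cycleP=> k /(congr1 val); rewrite /= FinRing.val_unitX => ->.
by rewrite rmorphXn /= fix_a.
Qed.

(* Lagrange interpolation at the conjugates of [alpha] isolates the identity
   automorphism in the sum over the Galois group that defines the trace. *)
Lemma trace_reconstruction :
  exists (m : nat) (alpha : Lq) (lam : 'I_m -> Lq),
    forall z, z = \sum_k lam k * tr (alpha ^+ k * z).
Proof.
have [alpha alphaP] := gal_separating_element.
(* This polynomial is 1 at [alpha] and 0 at all other conjugates. With its coefficients as [lam],
   exchanging the sums turns the right-hand side into the sum of [p.[g alpha] * g z] over all
   [g]. *)
pose p : {poly Lq} := \prod_(g : gal_of {:Lq} | g != 1%g)
  ((alpha - g alpha)^-1 *: ('X - (g alpha)%:P)).
have p1 : p.[alpha] = 1.
  rewrite horner_prod big1 // => g nt_g.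
  rewrite !hornerE mulVf // subr_eq0; apply: contraNneq nt_g => fix_a.
  exact/eqP/alphaP.
have p0 (g : gal_of {:Lq}) : g != 1%g -> p.[g alpha] = 0.
  by move=> nt_g; rewrite horner_prod (bigD1 g) //= !hornerE subrr !(mulr0, mul0r).
exists (size p), alpha, (fun k => p`_k) => z.
under eq_bigr => k _ do rewrite /galTrace mulr_sumr.
rewrite exchange_big /= (bigD1 1%g) ?group1 //= [X in _ + X]big1.
  rewrite addr0 -[LHS]mul1r -p1 horner_coef mulr_suml.
  by apply: eq_bigr => k _; rewrite gal_id mulrA.
move=> g /andP[_ nt_g]; transitivity (p.[g alpha] * g z); last by rewrite p0 ?mul0r.
rewrite horner_coef mulr_suml.
by apply: eq_bigr => k _; rewrite rmorphM rmorphXn mulrA.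
Qed.

Lemma trace_in_base (z : Lq) : exists t : F, tr z = t%:A.
Proof. by apply/vlineP; apply: mem_galTrace; rewrite ?memvf // finField_galois ?sub1v. Qed.

Lemma traceZ (t : F) (z : Lq) : tr (t%:A * z) = t%:A * tr z.
Proof.
rewrite /galTrace mulr_sumr; apply: eq_bigr => g _.
by rewrite rmorphM /= linearZ /= rmorph1.
Qed.

End Trace.

(** * Membership in star products *)

Section StarProduct.
Variables (K : finFieldType) (n : nat) (C : {vspace 'rV[K]_n}).

Lemma mem_star (E : {set 'rV[K]_n}) x y :
  x \in C -> y \in E -> map2_mx *%R x y \in star C E.
Proof. by move=> Cx Ey; apply/memv_span/allpairs_f; rewrite mem_enum. Qed.

Lemma sub_star (E : {set 'rV[K]_n}) (W : {vspace 'rV[K]_n}) :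
  (forall x y, x \in C -> y \in E -> map2_mx *%R x y \in W) ->
  (star C E <= W)%VS.
Proof.
move=> sW; apply/span_subvP=> _ /allpairsP[[x y] [/= Cx Ey ->]].
by rewrite !mem_enum in Cx Ey; apply: sW.
Qed.

End StarProduct.

(** * The trace code as a space over [F], its duality with [D], and its star products *)

Section TraceCode.
Variables (F : finFieldType) (L : fieldExtType F) (n : nat).
Local Notation Lq := (finvect_type L).
Local Notation tr := (galTrace 1%AS {:Lq}).
Variable D : {vspace 'rV[Lq]_n}.
Local Notation TrD := [set embed L y | y in trace_code D].

Lemma mem_trace_code (y : 'rV[F]_n) :
  reflect (exists2 x, x \in D & forall j, (y 0 j)%:A = tr (x 0 j))
          (y \in trace_code D).
Proof.
rewrite inE; apply: (iffP exists_inP) => -[x Dx eq_yx]; exists x => //.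
  by move=> j; move/eqP/rowP/(_ j): eq_yx; rewrite !mxE.
by apply/eqP/rowP=> j; rewrite !mxE; apply: eq_yx.
Qed.

Lemma trace_code_trace x :
  x \in D -> exists2 y, y \in trace_code D & forall j, (y 0 j)%:A = tr (x 0 j).
Proof.
move=> Dx; have /fin_all_exists[t tP] := fun j => trace_in_base (x 0 j).
exists (\row_j t j) => [|j]; last by rewrite mxE -tP.
by apply/mem_trace_code; exists x => // j; rewrite mxE -tP.
Qed.

Lemma trace_code_submod : submod_closed (trace_code D).
Proof.
split=> [|t y y' /mem_trace_code[x Dx xP] /mem_trace_code[x' Dx' xP']].
  apply/mem_trace_code; exists 0; first exact: mem0v.
  by move=> j; rewrite !mxE scale0r raddf0.
apply/mem_trace_code; exists (t%:A *: x + x'); first by rewrite rpredD ?rpredZ.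
by move=> j; rewrite !mxE scalerDl -scalerA xP' raddfD /= traceZ -xP mulr_algl.
Qed.

(** Makes the duality lemma for vector spaces applicable to the trace code, which is defined as a
    set. *)
Lemma trace_code_vspace :
  exists W : {vspace 'rV[F]_n}, forall y, (y \in W) = (y \in trace_code D).
Proof.
have [tr0 trS] := trace_code_submod.
exists <<enum (trace_code D)>>%VS => y; apply/idP/idP => [|Dy]; last first.
  by apply: memv_span; rewrite mem_enum.
move=> /(@coord_span _ _ _ (in_tuple _)) ->.
elim/big_rec: _ => // i v _ Dv; apply: trS => //.
by rewrite -mem_enum mem_nth.
Qed.

(** By [dual_supported_surj] it is enough that a word [a] over [F], supported on [T] and orthogonal
    to the trace code, vanishes. Such a word lies in the subfield subcode of the dual of [D], and
    its weight is below the minimum distance of that code. *)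
Lemma trace_code_surj (T : {set 'I_n}) :
  (#|T| <= mindist (subfield_subcode (dual_code D)) - 1)%N ->
  forall f : 'I_n -> F,
    exists2 y, y \in trace_code D & forall j, j \in T -> y 0 j = f j.
Proof.
move=> leT f; have [W memW] := trace_code_vspace.
have [a a0 aW|y] := @dual_supported_surj _ _ W T _ f; last by rewrite memW; exists y.
apply: eq0_supported_code a0 leT; rewrite !inE; apply/forall_inP=> x Dx.
  by rewrite /embed map_mx0 mul0mx.
have [m [alpha [lam reconstruct]]] := trace_reconstruction L.
apply/eqP/matrixP=> i0 j0; rewrite !ord1 [RHS]mxE [LHS]reconstruct.
(* As [a] has entries in [F], this trace is the inner product of [a] with the trace word of
   [alpha ^+ k *: x], which again comes from a word of [D]. *)
rewrite big1 // => k _; suff -> : tr (alpha ^+ k * (embed L a *m x^T) 0 0) = 0 by rewrite mulr0.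
have [y Dy yP] := trace_code_trace (rpredZ (alpha ^+ k) Dx).
rewrite -memW in Dy; have /rowP/(_ 0) := aW _ Dy.
rewrite !mxE mulr_sumr raddf_sum /= => /(congr1 (in_alg Lq)).
rewrite rmorph0 rmorph_sum => aW0; rewrite -[RHS]aW0; apply: eq_bigr => j _.
by rewrite rmorphM /= !mxE yP mxE mulrCA traceZ mulrC.
Qed.

(** Reconstructing [y] from the traces of its multiples [alpha ^+ k *: y] turns a product with [y]
    into a combination of products with trace words. *)
Lemma star_sub_star_trace (C : {vspace 'rV[Lq]_n}) :
  (star C [set x in D] <= star C TrD)%VS.
Proof.
apply: sub_star => x y Cx; rewrite inE => Dy.
have [m [alpha [lam reconstruct]]] := trace_reconstruction L.
have /fin_all_exists2[z Dz zP] := fun k : 'I_m => trace_code_trace (rpredZ (alpha ^+ k) Dy).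
suff -> : map2_mx *%R x y = \sum_k lam k *: map2_mx *%R x (embed L (z k)).
  by rewrite rpred_sum // => k _; rewrite rpredZ ?mem_star ?imset_f.
apply/rowP=> j; rewrite summxE mxE [y 0 j]reconstruct mulr_sumr.
by apply: eq_bigr => k _; rewrite !mxE /= zP mxE mulrCA.
Qed.

End TraceCode.

(** * The sets of servers and their arrangement *)

Section Blocks.
Variables (n m g N : nat) (pos : {perm 'I_n}) (f : 'I_m -> nat).
Hypotheses (g_gt0 : (0 < g)%N) (leNg : (N * g <= n)%N) (f_lt : forall x, (f x < N)%N).
Hypothesis f_inj : injective f.

(** The positions are cut into blocks of [g] consecutive ones, and [f] assigns a block to each [x].
    A pair corresponds to [x] and an offset inside its block. *)
Lemma card_block_pairs :
  #|[set p : 'I_m * 'I_n | (pos p.2 %/ g)%N == f p.1]| = (m * g)%N.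
Proof.
pose h (p : 'I_m * 'I_g) := (f p.1 * g + p.2)%N.
have h_div p : (h p %/ g)%N = f p.1 by rewrite divnMDl // divn_small ?addn0.
have h_lt p : (h p < n)%N.
  by apply: leq_trans leNg; rewrite -ltn_divLR // h_div.
pose h' p : 'I_m * 'I_n := (p.1, (pos^-1)%g (Ordinal (h_lt p))).
rewrite -[RHS](_ : #|[set h' p | p in setT]| = _); last first.
  rewrite card_imset ?cardsT ?card_prod ?card_ord // => -[x y] [x' y'] [] ->.
  by move/perm_inj/(congr1 val)/addnI/val_inj => /= ->.
apply: eq_card => -[x j]; rewrite inE /=; apply/eqP/imsetP => [jx|[p _ [-> ->]]].
  exists (x, Ordinal (ltn_pmod (pos j) g_gt0)); rewrite ?inE //.
  rewrite /h' /=; congr (_, _); apply: (canRL (permK _)); apply: val_inj.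
  by rewrite /h /= -jx -divn_eq.
by rewrite permKV /= h_div.
Qed.

(** Distinct [x] have disjoint blocks, so a server determines its pair. *)
Lemma card_block_union :
  #|[set j : 'I_n | [exists x, (pos j %/ g)%N == f x]]| = (m * g)%N.
Proof.
rewrite -card_block_pairs; set A := [set p : 'I_m * 'I_n | _].
rewrite -(card_in_imset (f := snd) (D := A)) => [|[x j] [x' j']]; last first.
  rewrite !inE /= => /eqP jx /eqP jx' eq_j; congr (_, _) => //.
  by apply: f_inj; rewrite -jx -jx' eq_j.
apply: eq_card => j; rewrite inE; apply/existsP/imsetP => [[x jx]|[[x j'] + ->]].
  by exists (x, j); rewrite ?inE.
by rewrite inE; exists x.
Qed.

End Blocks.

(** * Arithmetic of the parameters and the block structure of the sets [Jset] *)

Section SchemeSizes.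
Variables (K : finFieldType) (n : nat).
Variables (C : {vspace 'rV[K]_n}) (E : {set 'rV[K]_n}).
Hypothesis C_neq0 : C != 0%VS.
Local Notation c := (par_c C E).
Local Notation b := (par_b C E).
Local Notation s := (par_s C E).
Local Notation k := (\dim C).
Local Notation g := (c %/ b)%N.
Local Notation N := (maxn s b).

Lemma dim_code_gt0 : (0 < k)%N.
Proof. by rewrite lt0n dimv_eq0. Qed.

Lemma dim_code_leq : (k <= n)%N.
Proof. by have /dimvS := subvf C; rewrite dimvf /dim /= mul1n. Qed.

Lemma par_c_leq : (c <= n)%N.
Proof. by rewrite leq_subLR add1n mindist_leqSn. Qed.

Lemma par_bk : (b * k = s * c)%N.
Proof. by rewrite !divnK ?dvdn_lcml ?dvdn_lcmr. Qed.

Lemma par_b_gt0 : (0 < c)%N -> (0 < b)%N.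
Proof.
by move=> c_gt0; rewrite divn_gt0 ?dim_code_gt0 //
  dvdn_leq ?dvdn_lcmr // lcmn_gt0 c_gt0 dim_code_gt0.
Qed.

Lemma par_s_gt0 : (0 < c)%N -> (0 < s)%N.
Proof.
by move=> c_gt0; rewrite divn_gt0 // dvdn_leq ?dvdn_lcml // lcmn_gt0 c_gt0 dim_code_gt0.
Qed.

(** The degenerate case: there are no rows and no iterations, so statements about either hold
    vacuously. *)
Lemma par_eq0 : c = 0 -> b = 0 /\ s = 0.
Proof. by rewrite /par_b /par_s => ->; rewrite lcm0n div0n divn0. Qed.

Lemma par_bg : (b * g = c)%N.
Proof.
have [c0|c_gt0] := posnP c; first by have [-> _] := par_eq0 c0.
(* The quotient of [c] by [b] is the gcd, because lcm times gcd equals [c * k]. *)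
rewrite mulnC divnK //; apply/dvdnP; exists (gcdn c k).
apply/eqP; rewrite -(eqn_pmul2r dim_code_gt0) -mulnA par_bk /par_s divnK ?dvdn_lcml //.
by rewrite (mulnC (gcdn _ _)) muln_lcm_gcd.
Qed.

Lemma par_sg : (0 < c)%N -> (s * g = k)%N.
Proof.
move=> c_gt0; apply/eqP; rewrite -(eqn_pmul2l (par_b_gt0 c_gt0)).
by rewrite mulnCA par_bg par_bk.
Qed.

Lemma par_g_gt0 : (0 < c)%N -> (0 < g)%N.
Proof. by move=> c_gt0; move: c_gt0; rewrite -{1}par_bg muln_gt0 => /andP[]. Qed.

Lemma par_Ng : (0 < c)%N -> (N * g = maxn k c)%N.
Proof. by move=> c_gt0; rewrite maxnMl par_sg // par_bg. Qed.

(** The set J consists of [N] blocks of length [g], and the cyclic shift by [g] carries each block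
    to the next one; so after [u] shifts block [a] has become block [a + u] modulo [N]. *)
Lemma mem_Jset u a p :
  (0 < c)%N -> (a < b)%N -> (p \in Jset C E u a) = (p %/ g == (a + u) %% N)%N.
Proof.
move=> c_gt0 lt_ab; have g_gt0 := par_g_gt0 c_gt0.
have N_gt0 : (0 < N)%N by rewrite leq_max (par_b_gt0 c_gt0) orbT.
rewrite /Jset -par_Ng //; elim: u p => [|u IHu] p /=.
  rewrite mem_iota addn0 modn_small ?leq_max ?lt_ab ?orbT //.
  by rewrite eqn_leq leq_divRL // -[(_ %/ _ <= _)%N]ltnS ltn_divLR // andbC mulSn addnC.
have div_shift q : ((q + g) %% (N * g) %/ g = (q %/ g + 1) %% N)%N.
  by rewrite -modn_divl divnDr ?dvdnn // divnn g_gt0.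
apply/mapP/eqP => [[q + ->]|Dp].
  by rewrite IHu => /eqP Dq; rewrite div_shift Dq modnDml addn1 addnS.
(* The preimage of [p] under the shift: the preceding block, with the same offset. *)
exists ((a + u) %% N * g + p %% g)%N.
  by rewrite IHu divnMDl // divn_small ?ltn_pmod // addn0.
rewrite [LHS](divn_eq p g) [RHS](divn_eq _ g) div_shift.
rewrite divnMDl // (divn_small (ltn_pmod p g_gt0)) addn0 modnDml addn1 -addnS Dp.
by rewrite modn_dvdm ?dvdn_mull // modnDr modnMDl modn_mod.
Qed.

Lemma Jset_disjoint u a a' p :
  (a < b)%N -> (a' < b)%N -> p \in Jset C E u a -> p \in Jset C E u a' -> a = a'.
Proof.
move=> lt_ab lt_a'b; have [c0|c_gt0] := posnP c.
  by move: lt_ab; rewrite (par_eq0 c0).1.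
rewrite !mem_Jset // => /eqP -> /eqP/eqP; rewrite eqn_modDr.
by rewrite !modn_small ?leq_max ?lt_ab ?lt_a'b ?orbT // => /eqP.
Qed.

Lemma block_pos_leq : (0 < c)%N -> (N * g <= n)%N.
Proof. by move=> c_gt0; rewrite par_Ng // geq_max dim_code_leq par_c_leq. Qed.

Lemma card_Jset (pos : {perm 'I_n}) (u : 'I_s) :
  #|[set p : 'I_b * 'I_n | (pos p.2 : nat) \in Jset C E u p.1]| = c.
Proof.
have [c0|c_gt0] := posnP c.
  by case: u => u; rewrite (par_eq0 c0).2.
have f_lt (a : 'I_b) : ((a + u) %% N < N)%N.
  by rewrite ltn_pmod // leq_max (par_b_gt0 c_gt0) orbT.
rewrite -[RHS]par_bg -(card_block_pairs pos (par_g_gt0 c_gt0) (block_pos_leq c_gt0) f_lt).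
by apply: eq_card => p; rewrite !inE mem_Jset.
Qed.

(** Since [s <= N], the blocks visited by row [a] are pairwise distinct, and [s] blocks of length
    [g] make up [k] servers, the size of an information set. *)
Lemma card_Jset_row (pos : {perm 'I_n}) (a : 'I_b) :
  #|[set j | [exists u : 'I_s, (pos j : nat) \in Jset C E u a]]| = k.
Proof.
have [c0|c_gt0] := posnP c.
  by case: a => a; rewrite (par_eq0 c0).1.
have f_inj : injective (fun u : 'I_s => (a + u) %% N)%N.
  move=> u u' /eqP; rewrite eqn_modDl.
  by rewrite !modn_small ?leq_max ?ltn_ord // => /eqP/val_inj.
have f_lt (u : 'I_s) : ((a + u) %% N < N)%N.
  by rewrite ltn_pmod // leq_max (par_b_gt0 c_gt0) orbT.
rewrite -[RHS]par_sg // -(card_block_union pos (par_g_gt0 c_gt0) (block_pos_leq c_gt0) f_lt f_inj).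
by apply: eq_card => j; rewrite !inE; apply: eq_existsb => u; rewrite mem_Jset.
Qed.

Lemma Jset_lt u a p : (a < b)%N -> p \in Jset C E u a -> (p < maxn k c)%N.
Proof.
move=> lt_ab; have [c0|c_gt0] := posnP c.
  by move: lt_ab; rewrite (par_eq0 c0).1.
rewrite mem_Jset // -par_Ng // -ltn_divLR ?par_g_gt0 // => /eqP ->.
by rewrite ltn_pmod // leq_max (par_b_gt0 c_gt0) orbT.
Qed.

End SchemeSizes.

(** * Existence of an admissible arrangement *)

Lemma card_subset_exists (T : finType) (J : {set T}) (m : nat) :
  (m <= #|J|)%N -> exists2 J' : {set T}, J' \subset J & #|J'| = m.
Proof.
move=> le_mJ; exists [set x in take m (enum J)].
  by apply/subsetP=> x; rewrite inE => /mem_take; rewrite mem_enum.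
rewrite cardsE (card_uniqP _) ?take_uniq ?enum_uniq //.
by rewrite size_take_min -cardE (minn_idPl le_mJ).
Qed.

(** Number the elements of [J] first and those of its complement afterwards. *)
Lemma initial_segment_perm (n : nat) (J : {set 'I_n}) :
  exists pos : {perm 'I_n}, forall j, (pos j < #|J|)%N = (j \in J).
Proof.
pose r := enum J ++ enum (~: J).
have mem_r j : j \in r by rewrite mem_cat !mem_enum inE orbN.
have size_r : size r = n by rewrite size_cat -!cardE cardsC card_ord.
have index_lt j : (index j r < n)%N by rewrite -[X in (_ < X)%N]size_r index_mem.
have index_inj : injective (fun j => Ordinal (index_lt j)).
  by move=> j j' /(congr1 val) /=; apply: index_inj.
exists (perm index_inj) => j; rewrite permE /= index_cat mem_enum.
case: ifP => Jj; first by rewrite cardE index_mem mem_enum.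
by rewrite -cardE ltnNge leq_addr.
Qed.

Lemma mul_trmxD_delta (K : fieldType) (m : nat) (d y : 'cV[K]_m) (r : 'I_m) :
  ((d + delta_mx r 0)^T *m y) 0 0 = (d^T *m y) 0 0 + y r 0.
Proof. by rewrite raddfD mulmxDl /= trmx_delta -rowE [LHS]mxE; congr (_ + _); rewrite mxE. Qed.

Section Arrangement.
Variables (K : finFieldType) (n : nat) (C : {vspace 'rV[K]_n}).
Hypothesis C_neq0 : C != 0%VS.
Implicit Type E : {set 'rV[K]_n}.

(** A smaller [par_c] only allows a smaller [J], and the condition on [J] passes to its subsets. *)
Lemma arrangeable_leq E E' :
  (par_c C E' <= par_c C E)%N -> arrangeable C E -> arrangeable C E'.
Proof.
move=> le_c [le_ck|[J [cardJ infJ]]]; first by left; apply: leq_trans le_ck.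
right; have [|J' sJ'J cardJ'] := @card_subset_exists _ J (maxn (\dim C) (par_c C E')).
  by rewrite cardJ geq_max leq_maxl leq_max le_c orbT.
by exists J'; split=> // I sIJ'; apply: infJ; apply: subset_trans sIJ' sJ'J.
Qed.

(** When [par_c C E <= \dim C], any information set serves as [J], being its own only subset of that
    size. *)
Lemma arrangeable_servers E : arrangeable C E ->
  exists J : {set 'I_n}, #|J| = maxn (\dim C) (par_c C E) /\
    forall I : {set 'I_n}, I \subset J -> #|I| = \dim C -> information_set C I.
Proof.
case=> // le_ck; have [J infJ] := information_set_exists C.
exists J; rewrite infJ.1 (maxn_idPl le_ck); split=> // I sIJ cardI.
by have /eqP -> : I == J by rewrite eqEcard sIJ infJ.1 cardI /=.
Qed.

Lemma admissible_arrangement_exists E : arrangeable C E ->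
  exists pos : {perm 'I_n}, admissible_arrangement C E pos.
Proof.
case/arrangeable_servers=> J [cardJ infJ].
have [pos posJ] := initial_segment_perm J.
exists pos => a; apply: infJ; last exact: card_Jset_row.
apply/subsetP=> j; rewrite inE => /existsP[u] ju.
by rewrite -posJ cardJ; apply: Jset_lt ju.
Qed.

End Arrangement.

(** * Retrieval, rate and privacy *)

Section Retrieval.
Variables (K : finFieldType) (n mu : nat).
Variables (C : {vspace 'rV[K]_n}) (E : {set 'rV[K]_n}).
Hypothesis C_neq0 : C != 0%VS.
Variables (G : 'M[K]_(\dim C, n)) (pos : {perm 'I_n}).
Hypothesis genG : generator_matrix G.
Local Notation S := (star_scheme mu E G pos).
Implicit Types (x : 'I_mu -> file S) (i : 'I_mu) (w : coins S) (u : 'I_(par_s C E)).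

Definition download_set (u : nat) : {set 'I_n} :=
  [set j | [exists a : 'I_(par_b C E), (pos j : nat) \in Jset C E u a]].

(** What the unit vectors in the queries contribute to the responses. The sets for different rows
    [a] are disjoint, so at most one summand is nonzero and nothing is mixed up. *)
Definition download_word x i u : 'rV[K]_n := \row_j \sum_a downloaded G pos x i u a j.

Lemma card_download_set u : (#|download_set u| <= par_c C E)%N.
Proof.
rewrite -(card_Jset C_neq0 pos u).
apply: leq_trans (leq_imset_card (fun p : 'I_(par_b C E) * 'I_n => p.2) _).
apply/subset_leq_card/subsetP=> j; rewrite inE => /existsP[a ja].
by apply/imsetP; exists (a, j); rewrite ?inE.
Qed.

Lemma download_wordE x i u (a : 'I_(par_b C E)) j :
  (pos j : nat) \in Jset C E u a -> download_word x i u 0 j = (x i *m G) a j.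
Proof.
move=> ja; rewrite mxE (bigD1 a) //= mxE ja big1 ?addr0 // => a' neq_a.
rewrite mxE; case: ifP => // ja'; case/eqP: neq_a.
exact/val_inj/(Jset_disjoint C_neq0 (ltn_ord a') (ltn_ord a) ja' ja).
Qed.

Lemma download_word0 x i u j : j \notin download_set u -> download_word x i u 0 j = 0.
Proof.
rewrite inE negb_exists => /forallP j0; rewrite mxE big1 // => a _.
by rewrite mxE (negPf (j0 a)).
Qed.

Lemma stackE x i (a : 'I_(par_b C E)) j : (stack x *m G) (mxvec_index i a) j = (x i *m G) a j.
Proof. by rewrite !mxE; apply: eq_bigr => l _; rewrite mxE mxvecE mxE. Qed.

(** Isolates the part that a parity check matrix annihilates: the rows of [stack x *m G] are
    codewords of [C] when [G] generates it, so the sum over [r] lies in the star product. *)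
Lemma responsesE x i w u :
  row u (responses x i w) =
    \sum_r map2_mx *%R (row r (stack x *m G)) (val (w (u, r))) + download_word x i u.
Proof.
apply/rowP=> j; rewrite [in RHS]mxE summxE mxE mxE.
have sum_d : ((\col_r val (w (u, r)) 0 j)^T *m stored x j) 0 0 =
    \sum_r map2_mx *%R (row r (stack x *m G)) (val (w (u, r))) 0 j.
  by rewrite mxE; apply: eq_bigr => r _; rewrite !mxE mulrC.
rewrite -sum_d /= /star_query; case: pickP => [a ja|j0].
  rewrite (download_wordE _ _ ja) -stackE.
  rewrite (_ : (stack x *m G) _ j = col j (stack x *m G) (mxvec_index i a) 0).
    exact: mul_trmxD_delta.
  by rewrite [RHS]mxE.
by rewrite download_word0 ?addr0 // inE negb_exists; apply/forallP=> a; rewrite j0.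
Qed.

Lemma syndrome_responses r (H : 'M[K]_(r, n)) x i w u :
  parity_check (star C E) H ->
  H *m (row u (responses x i w))^T = H *m (download_word x i u)^T.
Proof.
move=> parH; rewrite responsesE raddfD mulmxDr [X in X + _](_ : _ = 0) ?add0r //.
apply/eqP; rewrite -parH rpred_sum // => l _; apply: mem_star; last exact: valP.
by rewrite genG.2 row_mul submxMl.
Qed.

Lemma responses_decodable r (H : 'M[K]_(r, n)) :
  parity_check (star C E) H ->
  exists dec : 'I_(par_s C E) -> 'cV[K]_r -> 'M[K]_(par_b C E, n),
    forall x i w u, dec u (H *m (row u (responses x i w))^T) = downloaded G pos x i u.
Proof.
move=> parH.
pose explains (u : 'I_(par_s C E)) (z : 'cV[K]_r) (v : 'rV[K]_n) :=
  (H *m v^T == z) && [forall (j | j \notin download_set u), v 0 j == 0].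
(* Decoding by search for a word on the download set with the given syndrome. The default 0 is never
   reached, as [download_word] qualifies; any two candidates differ by a word of the star product on
   at most [c] servers, so they agree. *)
pose word u z := odflt 0 [pick v | explains u z v].
exists (fun u z => \matrix_(a, j) if (pos j : nat) \in Jset C E u a then word u z 0 j else 0).
move=> x i w u; rewrite syndrome_responses //.
suff -> : word u (H *m (download_word x i u)^T) = download_word x i u.
  by apply/matrixP=> a j; rewrite [LHS]mxE [RHS]mxE; case: ifP => // ja; apply: download_wordE.
rewrite /word; case: pickP => [v /andP[/eqP Hv /forall_inP v0]|/(_ (download_word x i u))].
  apply/eqP; rewrite /= -subr_eq0; apply/eqP.
  apply: (@eq0_supported_code _ _ [set y in star C E] _ (download_set u)) => [||j ju|].
  - by rewrite inE mem0v.
  - by rewrite inE parH raddfB mulmxBr Hv subrr.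
  - by rewrite mxE [X in _ + X]mxE (eqP (v0 j ju)) download_word0 ?subr0.
  exact: card_download_set.
rewrite /explains eqxx /= => /negP[]; apply/forall_inP=> j ju.
by rewrite download_word0.
Qed.

(** If two files agree in all downloaded symbols, then for each row their encodings agree on an
    information set, hence everywhere, and [G] has independent rows. *)
Lemma file_reconstructible :
  admissible_arrangement C E pos ->
  exists rec : ('I_(par_s C E) -> 'M[K]_(par_b C E, n)) -> file S,
    forall x i, rec (fun u => downloaded G pos x i u) = x i.
Proof.
move=> adm.
pose symbols (m : file S) (u : 'I_(par_s C E)) : 'M[K]_(par_b C E, n) :=
  \matrix_(a, j) if (pos j : nat) \in Jset C E u a then (m *m G) a j else 0.
(* The default is never reached, because the file [x i] itself passes the test. *)
exists (fun f => odflt 0 [pick m | [forall u, symbols m u == f u]]) => x i.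
case: pickP => [m /forallP eq_m|/(_ (x i))/negP[]]; last first.
  by apply/forallP=> u; apply/eqP/matrixP=> a j; rewrite !mxE.
apply: (row_free_inj genG.1); apply/row_matrixP=> a; rewrite /= !row_mul.
apply/eqP; rewrite -subr_eq0 -mulmxBl; apply/eqP.
apply: (adm a).2 => [|j]; first by rewrite genG.2 submxMl.
rewrite inE => /existsP[u ja]; have /eqP/matrixP/(_ a j) := eq_m u.
rewrite mulmxBl -!row_mul [LHS]mxE ja [RHS]mxE ja => eq_aj.
by rewrite !mxE in eq_aj *; rewrite eq_aj subrr.
Qed.

(** A file has [b * k = s * c] symbols, and [s * n] symbols are downloaded. *)
Lemma star_rate : rate S = ((mindist [set x in star C E])%:R - 1) / n%:R.
Proof.
rewrite (_ : _ - 1 = (par_c C E)%:R); last by rewrite natrB ?mindist_gt0.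
rewrite /rate !dimvf /dim /=.
have [c0|c_gt0] := posnP (par_c C E).
  (* For [c = 0] nothing is downloaded; the convention that the inverse of 0 is 0 makes the rate 0,
     as required. *)
  by have [-> ->] := par_eq0 c0; rewrite c0 !mul0n invr0 mulr0 mul0r.
rewrite par_bk // !natrM invfM mulrACA divff ?mul1r //.
by rewrite Num.Theory.pnatr_eq0 -lt0n par_s_gt0.
Qed.

(* Translating the coins by suitable codewords turns the queries for one file,
   as seen by the servers in [T], into those for any other file. *)
Lemma star_collusion (t : nat) :
  {in E &, forall y y', y + y' \in E} ->
  {in E, forall y, - y \in E} ->
  (forall T : {set 'I_n}, (#|T| <= t)%N -> forall f : 'I_n -> bool,
     exists2 y, y \in E & forall j, j \in T -> y 0 j = (f j)%:R) ->
  protects_against_collusion S t.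
Proof.
move=> addE oppE surjE T leT i i' v.
(* The part of a query that depends on the desired file and not on the coins; its entries are 0 or
   1, which is why Boolean targets in [surjE] suffice. *)
pose offset i u j : 'cV[K]_(mu * par_b C E) :=
  if [pick a : 'I_(par_b C E) | (pos j : nat) \in Jset C E u a] is Some a
  then delta_mx (mxvec_index i a) 0 else 0.
have queryE i0 (w : coins S) u j :
    query i0 w u j = (\col_r val (w (u, r)) 0 j) + offset i0 u j.
  by rewrite /= /star_query /offset; case: pickP => // _; rewrite addr0.
have offset_bool i0 u r : exists2 y, y \in E & forall j, j \in T -> y 0 j = offset i0 u j r 0.
  have [y Ey yP] := surjE T leT (fun j => offset i0 u j r 0 == 1).
  exists y => // j /yP ->; rewrite /offset; case: pickP => [a _|_]; rewrite mxE.
    by case: (_ && _); rewrite ?eqxx // eq_sym oner_eq0.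
  by rewrite eq_sym oner_eq0.
have /fin_all_exists2[e Ee eP] : forall p : 'I_(par_s C E) * 'I_(mu * par_b C E),
    exists2 y, y \in E & forall j, j \in T -> y 0 j = offset i p.1 j p.2 0 - offset i' p.1 j p.2 0.
  move=> [u r]; have [y Ey yP] := offset_bool i u r; have [y' Ey' yP'] := offset_bool i' u r.
  by exists (y - y') => [|j Tj]; [rewrite addE ?oppE | rewrite !mxE yP ?yP'].
(* On [T] the added codewords [e] equal the difference of the two offsets, so queries for [i'] with
   shifted coins look like queries for [i]. As a bijection of the coins, [shift] preserves the
   count. *)
pose shift (w : coins S) : coins S :=
  [ffun p => exist _ (val (w p) + e p) (addE _ _ (valP (w p)) (Ee p))].
have shift_inj : injective shift.
  move=> w w' /ffunP eq_w; apply/ffunP=> p; apply: val_inj.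
  by have := eq_w p; rewrite !ffunE => /(congr1 val)/addIr.
have query_shift w u j : j \in T -> query i' (shift w) u j = query i w u j.
  move=> Tj; rewrite !queryE; apply/colP=> r; rewrite !mxE ffunE /= mxE eP //=.
  by rewrite -addrA subrK.
rewrite /pr; congr (_%:R / _).
rewrite -(card_imset _ shift_inj); apply: eq_card => w'.
have [shift' shiftK shift'K] := injF_bij shift_inj.
rewrite -(shift'K w') mem_imset // !unfold_in.
by apply: eq_forallb => u; apply: eq_forallb_in => j Tj; rewrite query_shift.
Qed.

End Retrieval.

(** * The scheme with the trace code as retrieval code *)

Section TraceScheme.
Variables (F : finFieldType) (L : fieldExtType F) (n mu : nat).
Local Notation Lq := (finvect_type L).
Variables (C D : {vspace 'rV[Lq]_n}).
Local Notation TrD := [set embed L y | y in trace_code D].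

Lemma trace_star_query (G : 'M[Lq]_(\dim C, n)) (pos : {perm 'I_n})
    (S := star_scheme mu TrD G pos) i (w : coins S) (u : 'I_(niter S)) j :
  exists v : 'cV[F]_(qlen S), query i w u j = map_mx (in_alg Lq) v.
Proof.
have [y _ yP] := fin_all_exists2 (fun r => imsetP (valP (w (u, r)))).
have yE : \col_r val (w (u, r)) 0 j = map_mx (in_alg Lq) (\col_r y r 0 j).
  by apply/colP=> r; rewrite !mxE yP mxE.
rewrite /= /star_query yE; case: pickP => [a _|_]; last by eexists.
by exists (\col_r y r 0 j + delta_mx (mxvec_index i a) 0); rewrite map_mxD map_delta_mx.
Qed.

(** The embedded trace code is closed under addition and opposites, and the 0/1 targets come from
    [F], so surjectivity over [F] is enough for [star_collusion]. *)
Lemma trace_star_collusion (G : 'M[Lq]_(\dim C, n)) (pos : {perm 'I_n}) :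
  protects_against_collusion (star_scheme mu TrD G pos)
    (mindist (subfield_subcode (dual_code D)) - 1).
Proof.
have [tr0 trS] := trace_code_submod D.
have trD y y' : y \in trace_code D -> y' \in trace_code D -> y + y' \in trace_code D.
  by move=> Dy Dy'; rewrite -[y]scale1r trS.
apply: star_collusion => [_ _ /imsetP[y Dy ->] /imsetP[y' Dy' ->]|_ /imsetP[y Dy ->]|T leT f].
- by rewrite /embed -map_mxD imset_f ?trD.
- rewrite /embed -map_mxN imset_f // -scaleN1r -[X in X \in _]addr0.
  exact: trS.
have [y Dy yP] := trace_code_surj leT (fun j => (f j)%:R).
exists (embed L y) => [|j Tj]; first by rewrite imset_f.
by rewrite mxE yP // rmorph_nat.
Qed.

End TraceScheme.

Theorem mainTheorem2 (F : finFieldType) (L : fieldExtType F) (n mu : nat)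
    (C D : {vspace 'rV[finvect_type L]_n}) (C_neq0 : C != 0%VS) :
  let TrD : {set 'rV[finvect_type L]_n} := [set embed L y | y in trace_code D] in
  let c := par_c C TrD in
  let b := par_b C TrD in
  let s := par_s C TrD in
  (* an arrangement of the servers for Tr(S) exists *)
  (arrangeable C [set x in D] -> arrangeable C TrD) /\
  (arrangeable C TrD ->
     exists pos : {perm 'I_n}, admissible_arrangement C TrD pos) /\
  forall (G : 'M[finvect_type L]_(\dim C, n)) (pos : {perm 'I_n}),
    generator_matrix G ->
    let TrS := star_scheme mu TrD G pos in
    (* low complexity: the queries have entries in F *)
    (forall (i : 'I_mu) (w : coins TrS) (u : 'I_(niter TrS)) (j : 'I_n),
       exists v : 'cV[F]_(qlen TrS),
         query i w u j = map_mx (in_alg (finvect_type L)) v) /\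
    (* c encoded symbols are recovered from the responses in each iteration *)
    (forall u : 'I_s,
       #|[set p : 'I_b * 'I_n | (pos p.2 : nat) \in Jset C TrD u p.1]| = c) /\
    (forall (r : nat) (H : 'M[finvect_type L]_(r, n)),
       parity_check (star C TrD) H ->
       exists dec : 'I_s -> 'cV[finvect_type L]_r -> 'M[finvect_type L]_(b, n),
         forall (x : 'I_mu -> file TrS) (i : 'I_mu) (w : coins TrS) (u : 'I_s),
           dec u (H *m (row u (responses x i w))^T)
           = downloaded G pos x i u) /\
    (* and the file is reconstructed from these symbols *)
    (admissible_arrangement C TrD pos ->
       exists rec : ('I_s -> 'M[finvect_type L]_(b, n)) -> file TrS,
         forall (x : 'I_mu -> file TrS) (i : 'I_mu),
           rec (fun u => downloaded G pos x i u) = x i) /\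
    rate TrS = ((mindist [set x in star C TrD])%:R - 1) / n%:R /\
    protects_against_collusion TrS
      (mindist (subfield_subcode (dual_code D)) - 1).
Proof.
move=> TrD c b s; split.
  (* Passing from [D] to its trace code enlarges the star product, so [par_c] can only decrease. *)
  apply: arrangeable_leq; rewrite leq_sub2r // mindist_subset //.
  apply/subsetP=> x; rewrite !inE.
  exact/subvP/star_sub_star_trace.
split; first exact: admissible_arrangement_exists.
move=> G pos genG TrS; split; first exact: trace_star_query.
split; first exact: card_Jset.
split; first by move=> r H; apply: responses_decodable.
split; first exact: file_reconstructible.
split; first exact: star_rate.
exact: trace_star_collusion.
Qed.
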